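(* Let $\mathcal F$ be a Euclidean field such that every polynomial of odd degree in $\mathcal F[x]$ has a root in $\mathcal F$. Then the field $\mathcal F(\sqrt{-1})$ is algebraically closed.
   Context: All fields are assumed to have characteristic different from $2$. For a field $\mathcal F$, let $\sigma(\mathcal F)$ denote the set of elements of $\mathcal F$ that are (finite) sums of squares in $\mathcal F$. The field $\mathcal F$ is formally real if $-1\notin\sigma(\mathcal F)$. Write $\mathcal F^\times=\mathcal F\setminus\{0\}$ and let $\mathcal F^{\times 2}$ be the set of squares of elements of $\mathcal F^\times$. A field $\mathcal F$ is Euclidean if it is formally real and $\mathcal F^\times=\mathcal F^{\times 2}\cup(-\mathcal F^{\times 2})$; equivalently, it is an ordered field in which every non-negative element is a square. $\mathcal F(\sqrt{-1})$ denotes the field obtained from $\mathcal F$ by adjoining a square root of $-1$. *)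

(* Defs.v *)
From HB Require Import structures.
From mathcomp Require Import all_boot all_order all_algebra all_field.

Set Implicit Arguments.
Unset Strict Implicit.
Unset Printing Implicit Defensive.

Import GRing.Theory.
Local Open Scope ring_scope.

Definition sum_of_squares (F : fieldType) (x : F) : Prop :=
  exists s : seq F, x = \sum_(y <- s) y ^+ 2.

Definition formally_real (F : fieldType) : Prop := ~ sum_of_squares (-1 : F).

Definition nonzero_square (F : fieldType) (x : F) : Prop :=
  exists2 y : F, y != 0 & x = y ^+ 2.

Definition euclidean_field (F : fieldType) : Prop :=
  formally_real F /\
  forall x : F, x != 0 <-> nonzero_square x \/ nonzero_square (- x).

(* L = F(i) for some square root i of -1.  This characterizes F(sqrt(-1)) up to
   F-isomorphism; adjoin_sqrtN1_exists shows that such an L exists when F is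
   formally real. *)
Definition adjoins_sqrtN1 (F : fieldType) (L : fieldExtType F) : Prop :=
  exists2 i : L, i ^+ 2 = -1 & <<1; i>>%VS = {:L}%VS.

Lemma adjoin_sqrtN1_exists (F : fieldType) :
  formally_real F -> exists L : fieldExtType F, adjoins_sqrtN1 L.
Proof.
move=> Freal; pose p : {poly F} := 'X^2 + 1.
have size_p : size p = 3%N by rewrite size_XnaddC.
have irr_p : irreducible_poly p.
  apply: cubic_irreducible => [|x]; first by rewrite size_p.
  apply/negP; rewrite rootE !hornerE addr_eq0 => /eqP x2.
  by apply: Freal; exists [:: x]; rewrite big_seq1 -x2.
have [L _ [i pi0 Li]] := irredp_FAdjoin irr_p; exists L, i => //.
move: pi0; rewrite rmorphD rmorph1 /= map_polyXn rootE !hornerE.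
by rewrite addr_eq0 => /eqP.
Qed.

(* Main.v *)
Require Import Defs.
From HB Require Import structures.
From mathcomp Require Import all_boot all_order all_algebra all_field.
From mathcomp Require Import all_fingroup all_solvable.
From mathcomp Require Import ring.
From Stdlib Require Import Classical.
Import GRing.Theory.
Local Open Scope ring_scope.

(** The proof is Artin's: Galois theory reduces the algebraic closedness of
F(i) to two facts about F, the existence of roots for polynomials of odd degree
and the existence of square roots in F(i).

Let E be a splitting field over F (hence Galois, as the characteristic is zero)
that contains a square root j of -1.  The fixed field of a Sylow 2-subgroup of
Gal(E / F) is generated by an element whose minimal polynomial over F is
irreducible of odd degree.  Such a polynomial has a root in F, so it is linear
and the Galois group is a 2-group ([odd_root_galois_2group]).  If its subgroup
Gal(E / F(j)) were nontrivial, it would have a subgroup of index 2, hence F(j)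
would have a quadratic extension; completing the square shows that this cannot
be, since every element of F(j) is a square ([euclidean_sqrt_Fadjoin]).
Therefore E = F(j) ([euclidean_splitting_field]).

To find a root in L = F(i) of a nonconstant p over L, write p = u + i v with u
and v over F.  The norm q = u^2 + v^2 = (u - i v)(u + i v) has its coefficients
in F and is a multiple of p.  Over some extension M of L, the polynomial
q (X^2 + 1) splits; its roots generate over F a splitting field S that contains
i as well as a root a of p.  As S = F(i), the root a lies in L. *)

(** * Splitting fields over an arbitrary field *)

Lemma exists_irreducible_factor (K : fieldType) (p : {poly K}) :
  (1 < size p)%N -> exists2 r, irreducible_poly r & r %| p.
Proof.
have [n] := ubnP (size p); elim: n p => // n IHn p /ltnSE le_pn p_gt1.
have [irr_p | red_p] := classic (irreducible_poly p); first by exists p.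
have [d []] : exists d : {poly K}, [/\ size d != 1, d %| p & ~~ (d %= p)].
  apply: NNPP => no_d; apply: red_p; split=> // d d1 dp.
  by apply/idPn=> ndp; apply: no_d; exists d.
move=> d1 d_p nd_p; have nz_p : p != 0 by rewrite -size_poly_gt0 ltnW.
have d_gt1 : (1 < size d)%N.
  by rewrite ltn_neqAle eq_sym d1 size_poly_gt0 (dvdpN0 d_p).
have lt_dp : (size d < size p)%N.
  by rewrite ltn_neqAle dvdp_size_eqp // nd_p dvdp_leq.
have [r irr_r r_d] := IHn d (leq_trans lt_dp le_pn) d_gt1.
by exists r; last exact: dvdp_trans d_p.
Qed.

(** The successive adjunctions of roots build a tower over K, and each step is
turned back into an extension of the bottom field by [baseFieldType]. *)
Lemma exists_splitting_extension (K : fieldType) (p : {poly K}) : p != 0 ->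
  exists (L : fieldExtType K) (zs : seq L),
    map_poly (in_alg L) p %= \prod_(z <- zs) ('X - z%:P).
Proof.
have [n] := ubnP (size p); elim: n K p => // n IHn K p /ltnSE le_pn nz_p.
have [Cp | C'p] := leqP (size p) 1.
  exists K^o, [::].
  by rewrite big_nil -size_poly_eq1 size_map_poly eqn_leq Cp size_poly_gt0.
have [r irr_r r_p] := exists_irreducible_factor _ _ C'p.
have [E _ [x rx0 _]] := irredp_FAdjoin irr_r.
have /factor_theorem[q Dp] : root (map_poly (in_alg E) p) x.
  by rewrite -(divpK r_p) rmorphM rootM rx0 orbT.
have nz_q : q != 0.
  apply: contra_neq nz_p => q0; apply/eqP.
  by rewrite -(map_poly_eq0 (in_alg E)) Dp q0 mul0r.
have lt_qn : (size q < n)%N.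
  by move: le_pn; rewrite -(size_map_poly (in_alg E)) Dp size_Mmonic ?monicXsubC
    // size_XsubC addn2.
have [L [zs Dq]] := IHn E q lt_qn nz_q.
exists (baseFieldType L), (in_alg L x :: zs).
rewrite (eq_map_poly (fun a : K => baseField_scaleE (L := L) a 1)).
rewrite big_cons (map_poly_comp (in_alg L) (in_alg E)) Dp mulrC rmorphM /=.
by rewrite rmorphB /= map_polyX map_polyC eqp_mull.
Qed.

(** The extension E may be larger than what the roots generate, and it need not
be normal over F; the subfield that the roots generate is. *)
Lemma exists_splitting_subfield {F : fieldType} {E : fieldExtType F}
    {p : {poly F}} {zs : seq E} :
    map_poly (in_alg E) p %= \prod_(z <- zs) ('X - z%:P) ->
  exists (S : splittingFieldType F) (f : 'AHom(S, E)),
    {in zs, forall z, exists s, f s = z}.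
Proof.
move=> Dp; pose S := subvs_of <<1 & zs>>%AS.
pose f := linfun_ahom (vsval : {lrmorphism S -> E}).
have fE s : f s = val s by rewrite /= lfunE.
have f_onto z : z \in zs -> f (vsproj _ z) = z.
  by move=> zs_z; rewrite fE /= vsprojK ?seqv_sub_adjoin.
pose ws : seq S := map (vsproj _) zs.
have Dzs : map f ws = zs by rewrite -map_comp map_id_in.
suffices splitS : SplittingField.axiom S.
  pose T : splittingFieldType F :=
    HB.pack S (FieldExt_isSplittingField.Build F S splitS).
  by exists T, f => z /f_onto Dz; exists (vsproj _ z).
exists (map_poly (in_alg S) p); first exact: alg_polyOver.
exists ws.
  rewrite -(eqp_map f) -map_poly_comp.
  rewrite (eq_map_poly (g := in_alg E)) => [|x]; last exact: rmorph_alg.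
  rewrite rmorph_prod (eq_bigr (fun t => 'X - (f t)%:P)) => [|t _].
    by rewrite -(big_map f xpredT (fun z => 'X - z%:P)) Dzs.
  by rewrite rmorphB /= map_polyX map_polyC.
apply/vspaceP=> s; rewrite memvf.
have: f s \in (f @: <<1 & ws>>)%VS.
  by rewrite aimg_adjoin_seq aimg1 Dzs fE subvsP.
by case/memv_imgP=> t ws_t /fmorph_inj->.
Qed.

(** * Square roots in F(i) for F Euclidean *)

Lemma formally_real_sum_eq0 {F : fieldType} (s : seq F) (x : F) :
  formally_real F -> \sum_(y <- s) y ^+ 2 + x ^+ 2 = 0 -> x = 0.
Proof.
move=> Freal s0; apply/eqP/negPn/negP=> nz_x; apply: Freal.
exists [seq y / x | y <- s]; rewrite big_map.
under eq_bigr do rewrite expr_div_n.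
by rewrite -mulr_suml (canRL (addrK _) s0) sub0r mulNr divff ?expf_neq0.
Qed.

(** In characteristic p, -1 = p - 1 is a sum of p - 1 copies of 1 = 1^2. *)
Lemma formally_real_pchar0 {F : fieldType} :
  formally_real F -> [pchar F] =i pred0.
Proof.
move=> Freal p; apply/negP=> /andP[/prime_gt0 p_gt0 /eqP p0]; apply: Freal.
exists (nseq p.-1 1).
rewrite big_nseq expr1n iter_addr_0; apply/eqP.
by rewrite eq_sym -subr_eq0 opprK -mulrSr prednK ?p0.
Qed.

Lemma euclidean_square_or_opp {F : fieldType} (x : F) :
  euclidean_field F -> exists y, x = y ^+ 2 \/ x = - y ^+ 2.
Proof.
case=> _ sqF; have [-> | /sqF[] [y _ Dy]] := eqVneq x 0.
- by exists 0; left; rewrite expr0n.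
- by exists y; left.
- by exists y; right; rewrite -Dy opprK.
Qed.

(** If x^2 + y^2 were -n^2 rather than a square, n would vanish because F is
formally real. *)
Lemma euclidean_sum_two_squares {F : fieldType} (x y : F) :
  euclidean_field F -> exists n, x ^+ 2 + y ^+ 2 = n ^+ 2.
Proof.
move=> euclF.
have [n [] Dn] := euclidean_square_or_opp (x ^+ 2 + y ^+ 2) euclF.
  by exists n.
exists 0; rewrite Dn (formally_real_sum_eq0 [:: x; y] n euclF.1) ?oppr0 //.
  by rewrite expr0n oppr0.
by rewrite !big_cons big_nil addr0 Dn addNr.
Qed.

(** These are the equations for (u + i v)^2 = x + i y.  With n^2 = x^2 + y^2,
one expects u^2 = (x + n) / 2 and v^2 = (n - x) / 2, with u v = y / 2.  The
sign of n is left undetermined: for either choice (x + n) / 2 is u^2 or -u^2,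
and in the second case u serves as the imaginary part, because n is then the
negative root. *)
Lemma euclidean_complex_sqrt {F : fieldType} (x y : F) : euclidean_field F ->
  exists u v, x = u ^+ 2 - v ^+ 2 /\ y = u * v *+ 2.
Proof.
move=> euclF; have sqF z := euclidean_square_or_opp z euclF.
have nz2 : 2 != 0 :> F.
  by move/pcharf0P: (formally_real_pchar0 euclF.1) => ->.
have [-> | nz_y] := eqVneq y 0.
  have [u [] ->] := sqF x.
    by exists u, 0; rewrite expr0n subr0 mulr0 mul0rn.
  by exists 0, u; rewrite expr0n sub0r mul0r mul0rn.
have [n Dn] := euclidean_sum_two_squares x y euclF.
pose c := (x + n) / 2.
have Dy : y ^+ 2 = 2 ^+ 2 * c * (c - x).
  have -> : y ^+ 2 = n ^+ 2 - x ^+ 2 by rewrite -Dn addrC addKr.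
  by rewrite /c; field.
have nz_c : c != 0.
  apply: contra_neq nz_y => c0; apply/eqP.
  by rewrite -sqrf_eq0 Dy c0 mulr0 mul0r.
have [u Du] := sqF c.
have nz_u : u != 0.
  by apply: contra_neq nz_c => u0; case: Du; rewrite u0 expr0n ?oppr0.
have Dhalf : (y / (2 * u)) ^+ 2 = c * (c - x) / u ^+ 2.
  by rewrite expr_div_n Dy; field; rewrite nz_u nz2.
have Dprod : y = u * (y / (2 * u)) *+ 2 by field; rewrite nz_u nz2.
case: Du => Dc; [exists u, (y / (2 * u)) | exists (y / (2 * u)), u].
  by rewrite Dhalf -Dc mulrAC divff // mul1r subKr.
split; last by rewrite [y / _ * _]mulrC.
rewrite Dhalf -[u ^+ 2]opprK -Dc invrN mulrN mulrAC divff // mul1r.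
by rewrite opprB opprK subrK.
Qed.

Lemma Fadjoin_sqrtN1_coord {F : fieldType} {L : fieldExtType F} {i z : L} :
  i ^+ 2 = -1 -> z \in <<1; i>>%VS -> exists x y : F, z = x%:A + y *: i.
Proof.
move=> i2 /Fadjoin1_polyP[p ->{z}]; elim/poly_ind: p => [|p c [x [y Dp]]].
  by exists 0, 0; rewrite rmorph0 horner0 !scale0r addr0.
exists (c - y), x; rewrite rmorphD rmorphM /= map_polyX map_polyC !hornerE Dp.
rewrite mulrDl -!scalerAl mul1r -expr2 i2 scalerBl scalerN.
by rewrite addrC [in LHS](addrC (x *: i)) addrA.
Qed.

Lemma euclidean_sqrt_Fadjoin {F : fieldType} {L : fieldExtType F} {i z : L} :
    euclidean_field F -> i ^+ 2 = -1 -> z \in <<1; i>>%VS ->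
  exists2 w, w \in <<1; i>>%VS & z = w ^+ 2.
Proof.
move=> euclF i2 /(Fadjoin_sqrtN1_coord i2)[x [y ->{z}]].
have [u [v [-> ->]]] := euclidean_complex_sqrt x y euclF.
exists (u%:A + v *: i).
  by rewrite memvD ?memvZ ?mem1v ?memv_adjoin.
rewrite sqrrD !exprZn i2 expr1n -scalerAl mul1r scalerA.
by rewrite scalerBl scalerN scalerMnl addrAC.
Qed.

(** * The Galois groups *)

(** By completing the square in the minimal polynomial of w. *)
Lemma adjoin_degree_neq2 {F : fieldType} {L : fieldExtType F}
    (K : {subfield L}) (w : L) :
    (2 : L) != 0 -> (forall z, z \in K -> exists2 y, y \in K & z = y ^+ 2) ->
  adjoin_degree K w != 2%N.
Proof.
move=> nz2 sqrtK; apply/eqP=> deg2; pose p := minPoly K w.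
have sz_p : size p = 3%N by rewrite size_minPoly deg2.
have p2 : p`_2 = 1.
  by have /monicP := monic_minPoly K w; rewrite lead_coefE -/p sz_p.
have Kp k : p`_k \in K by apply: polyOverP; apply: minPolyOver.
have K2 : 2 \in K by rewrite -[2]/(1 + 1) rpredD ?rpred1.
have pw0 : p`_0 + p`_1 * w + w ^+ 2 = 0.
  have := minPolyxx K w; rewrite -/p horner_coef sz_p !big_ord_recl big_ord0 /=.
  by rewrite p2 expr0 expr1 mulr1 mul1r addr0 addrA.
pose b := p`_1 / 2; have Kb : b \in K by rewrite rpred_div.
have [y Ky Dy] : exists2 y, y \in K & b ^+ 2 - p`_0 = y ^+ 2.
  by apply: sqrtK; rewrite rpredB ?rpredX.
have /eqP : (w + b) ^+ 2 = y ^+ 2.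
  rewrite -[LHS]subr0 -[X in _ - X]pw0 -Dy /b; field.
  exact: nz2.
have: w \notin K by rewrite -adjoin_deg_eq1 deg2.
rewrite eqf_sqr => /negP Kw /orP[]/eqP Dw; case: Kw.
  by rewrite -(addrK b w) Dw rpredB.
by rewrite -(addrK b w) Dw rpredB ?rpredN.
Qed.

(** The element w generates the fixed field of G over K. *)
Lemma fixedField_primitive {F : fieldType} {E : splittingFieldType F}
    {K : {subfield E}} {G : {group gal_of {:E}}} :
    galois K {:E} -> G \subset 'Gal({:E} / K)%g ->
  exists w : E, adjoin_degree K w = #|'Gal({:E} / K)%g : G|%g.
Proof.
move=> galE sG; have [_ sepE _] := and3P galE.
have sKfix : (K <= fixedField G)%VS by rewrite -galois_connection ?subvf.
have sepfix : separable K (fixedField G) := separableSr (subvf _) sepE.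
exists (separable_generator K (fixedField G)).
rewrite adjoin_degreeE -(eq_adjoin_separable_generator sepfix) //.
exact: dim_fixed_galois.
Qed.

(** The index of a Sylow 2-subgroup is the degree of an irreducible polynomial
over F; being odd, it is 1 because this polynomial has a root in F. *)
Lemma odd_root_galois_2group {F : fieldType} (E : splittingFieldType F) :
    (forall p : {poly F}, odd (size p).-1 -> exists x : F, root p x) ->
  galois 1 {:E} -> (2.-group 'Gal({:E} / 1))%g.
Proof.
move=> odd_root galE.
have [P /and3P[sPG evenP oddPG]] := Sylow_exists 2 'Gal({:E} / 1)%g.
have [w Dw] := fixedField_primitive galE sPG.
have /polyOver1P[p Dp] := minPolyOver 1%AS w.
have sz_p : size p = (adjoin_degree 1%AS w).+1.
  by rewrite -size_minPoly Dp size_map_poly.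
have [|x px0] := odd_root p; first by rewrite sz_p Dw odd_2'nat.
have : ('X - (x%:A)%:P %= minPoly 1%AS w) || ('X - (x%:A : E)%:P %= 1).
  apply: minPoly_irr; first by rewrite polyOverXsubC rpredZ ?rpred1.
  by rewrite Dp dvdp_XsubCl fmorph_root.
rewrite -size_poly_eq1 size_XsubC orbF => /eqp_size.
rewrite size_XsubC size_minPoly Dw => - [/esym/eqP].
by rewrite indexg_eq1 => /(conj sPG)/andP; rewrite -eqEsubset => /eqP <-.
Qed.

(** A nontrivial 2-group has a subgroup of index 2, whose fixed field is a
quadratic extension of K. *)
Lemma galois_2group_trivial {F : fieldType} {E : splittingFieldType F}
    {K : {subfield E}} :
    (2 : E) != 0 -> (forall z, z \in K -> exists2 y, y \in K & z = y ^+ 2) ->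
    galois K {:E} -> (2.-group 'Gal({:E} / K))%g ->
  K = {:E}%VS :> {vspace E}.
Proof.
move=> nz2 sqrtK galE evenG; have [sKE _ _] := and3P galE.
have [G1 | ntG] := eqVneq 'Gal({:E} / K)%G 1%G.
  apply/eqP; rewrite eqEdim sKE (dim_sup_field sKE) galois_dim //.
  by have /= -> := congr1 val G1; rewrite cards1 mul1n.
have [_ _ [k oG]] := pgroup_pdiv evenG ntG.
have [P [sPG _ oP]] := normal_pgroup evenG (normal_refl _) (leq_pred _).
have [w Dw] := fixedField_primitive galE sPG.
have /eqP[] := adjoin_degree_neq2 K w nz2 sqrtK.
by rewrite Dw -divgS // oP oG pfactorK // -expnB ?subSnn.
Qed.

Lemma euclidean_splitting_field {F : fieldType} {E : splittingFieldType F}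
    {j : E} :
    euclidean_field F ->
    (forall p : {poly F}, odd (size p).-1 -> exists x : F, root p x) ->
  j ^+ 2 = -1 -> <<1; j>>%VS = {:E}%VS.
Proof.
move=> euclF odd_root j2; have pcharF := formally_real_pchar0 euclF.1.
have pcharE : [pchar E] =i pred0 by move=> p; rewrite pchar_lalg pcharF.
have galE : galois 1 {:E}.
  apply/and3P; split; [exact: sub1v | | exact: normalFieldf].
  by apply/separableP=> u _; apply: pcharf0_separable.
apply: (@galois_2group_trivial F E <<1; j>>%AS).
- by move/pcharf0P: pcharE => ->.
- by move=> z; apply: euclidean_sqrt_Fadjoin.
- by apply: galoisS galE; rewrite sub1v subvf.
- apply: pgroupS (odd_root_galois_2group E odd_root galE).
  by rewrite galS ?sub1v.
Qed.

(** * Roots of polynomials over F(i) *)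

Lemma sqrtN1_poly_coord {F : fieldType} {L : fieldExtType F} {i : L}
    (p : {poly L}) : i ^+ 2 = -1 -> <<1; i>>%VS = {:L}%VS ->
  exists u v : {poly F}, p = map_poly (in_alg L) u + i *: map_poly (in_alg L) v.
Proof.
move=> i2 Li; elim/poly_ind: p => [|p c [u [v ->]]].
  by exists 0, 0; rewrite !rmorph0 scaler0 addr0.
have [|x [y ->]] := Fadjoin_sqrtN1_coord i2 (z := c); first by rewrite Li memvf.
exists (u * 'X + x%:P), (v * 'X + y%:P).
rewrite !rmorphD !rmorphM /= !map_polyX !map_polyC /= -(mulr_algl y i).
by rewrite polyCM -!(mul_polyC i); ring.
Qed.

(** For p = u + i v the multiple is its norm q = u^2 + v^2. *)
Lemma norm_poly {F : fieldType} {L : fieldExtType F} {p : {poly L}} :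
    formally_real F -> adjoins_sqrtN1 L -> p != 0 ->
  exists2 q : {poly F}, q != 0 & p %| map_poly (in_alg L) q.
Proof.
move=> Freal [i i2 Li] nz_p; have [u [v Dp]] := sqrtN1_poly_coord p i2 Li.
set U := map_poly _ u in Dp; set V := map_poly _ v in Dp.
pose q := u ^+ 2 + v ^+ 2.
have Dq : map_poly (in_alg L) q = (U - i *: V) * p.
  by rewrite Dp -subr_sqr exprZn i2 scaleN1r opprK rmorphD !rmorphXn.
exists q; last by rewrite Dq dvdp_mull.
rewrite -(map_poly_eq0 (in_alg L)) Dq mulf_neq0 //.
(* If the conjugate u - i v vanishes then so does p, because comparing squares
   of coefficients gives u_k^2 + v_k^2 = 0 in the formally real field F. *)
apply: contra_neq nz_p => /eqP; rewrite subr_eq0 => /eqP/polyP Duv.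
have uv0 k : u`_k = 0 /\ v`_k = 0.
  have uv2 : u`_k ^+ 2 + v`_k ^+ 2 = 0.
    apply: (fmorph_inj (in_alg L)); apply/eqP.
    rewrite rmorph0 rmorphD !rmorphXn /= addr_eq0.
    have := Duv k; rewrite coefZ !coef_map /= => ->.
    by rewrite exprMn i2 mulN1r.
  have sum1 x : \sum_(y <- [:: x : F]) y ^+ 2 = x ^+ 2 by rewrite big_seq1.
  split; last by apply: (formally_real_sum_eq0 [:: u`_k]) => //; rewrite sum1.
  by apply: (formally_real_sum_eq0 [:: v`_k]) => //; rewrite sum1 addrC.
apply/polyP=> k; rewrite Dp coefD coefZ !coef_map coef0 /=.
by have [-> ->] := uv0 k; rewrite !scale0r mulr0 addr0.
Qed.

(** A splitting field over F that contains both a root a of p and a square root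
of -1 is F(i), so that a = x + i y with x and y in F. *)
Lemma adjoins_sqrtN1_has_root {F : fieldType} {L : fieldExtType F}
    (p : {poly L}) :
    euclidean_field F ->
    (forall p : {poly F}, odd (size p).-1 -> exists x : F, root p x) ->
  adjoins_sqrtN1 L -> (1 < size p)%N -> exists z, root p z.
Proof.
move=> euclF odd_root adjL p_gt1; have [i i2 _] := adjL.
have nz_p : p != 0 by rewrite -size_poly_gt0 ltnW.
have [q nz_q p_q] := norm_poly euclF.1 adjL nz_p.
(* The factor X^2 + 1 makes the splitting field of q1 contain i. *)
pose q1 := q * ('X^2 + 1); pose q1L := map_poly (in_alg L) q1.
have nz_q1L : q1L != 0.
  by rewrite map_poly_eq0 mulf_neq0 // -size_poly_gt0 size_XnaddC.
have [M [zs Dzs]] := exists_splitting_extension L q1L nz_q1L.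
have zs_root (z : M) : root (map_poly (in_alg M) q1L) z -> z \in zs.
  by rewrite (eqp_root Dzs) root_prod_XsubC.
have zs_i : i%:A \in zs.
  apply: zs_root; rewrite fmorph_root [q1L]rmorphM rmorphD rmorph1 /=.
  by rewrite map_polyXn rootM [X in _ || X]rootE !hornerE i2 addNr eqxx orbT.
have [a zs_a pa0] : exists2 a, a \in zs & root (map_poly (in_alg M) p) a.
  have p_zs : map_poly (in_alg M) p %| \prod_(z <- zs) ('X - z%:P).
    by rewrite -(eqp_dvdr _ Dzs) dvdp_map [q1L]rmorphM dvdp_mulr.
  have [m Dm] := dvdp_prod_XsubC p_zs.
  case Ds: (mask m zs) Dm => [|a s] Dm.
    move: (eqp_size Dm) p_gt1.
    by rewrite big_nil size_poly1 size_map_poly => ->.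
  exists a; first by apply: (mem_mask (m := m)); rewrite Ds mem_head.
  by rewrite (eqp_root Dm) root_prod_XsubC mem_head.
have Dzs1 :
    map_poly (in_alg (baseFieldType M)) q1 %= \prod_(z <- zs) ('X - z%:P).
  rewrite (eq_map_poly (fun a : F => baseField_scaleE (L := M) a 1)).
  by rewrite (map_poly_comp (in_alg M) (in_alg L)).
have [S [f fzs]] := exists_splitting_subfield Dzs1.
have [[j Dj] [b Db]] := (fzs _ zs_i, fzs _ zs_a).
have j2 : j ^+ 2 = -1.
  apply: (fmorph_inj f); rewrite rmorphXn rmorphN1 /= Dj.
  by have := congr1 (in_alg M) i2; rewrite rmorphXn rmorphN1.
have Sj := euclidean_splitting_field euclF odd_root j2.
have [|x [y Dxy]] := Fadjoin_sqrtN1_coord j2 (z := b).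
  by rewrite Sj memvf.
have Da : a = in_alg M (x%:A + y *: i).
  rewrite -Db Dxy linearD !linearZ /= rmorph1 Dj !baseField_scaleE.
  by rewrite scalerDl scalerA mulr_algl.
by exists (x%:A + y *: i); move: pa0; rewrite Da fmorph_root.
Qed.

Theorem theorem4p2 (F : fieldType) (charF : 2%N \notin [pchar F])
  (euclF : euclidean_field F)
  (odd_root : forall p : {poly F}, odd (size p).-1 -> exists x : F, root p x)
  (L : fieldExtType F) (adjL : adjoins_sqrtN1 L) :
  GRing.closed_field_axiom L.
Proof.
move=> n P n_gt0; pose p := 'X^n - \poly_(i < n) P i.
have sz_p : size p = n.+1.
  by rewrite size_polyDl ?size_polyXn // size_polyN ltnS size_poly.
have [|z] := adjoins_sqrtN1_has_root p euclF odd_root adjL.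
  by rewrite sz_p.
by rewrite rootE !hornerE horner_poly subr_eq0 => /eqP; exists z.
Qed.
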